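(* Let $f : \mathbb{N} \to \mathbb{N}$ be a function which grows faster than every computable function. Then the group $B_f$: (1) is not finitely presented; and (2) has unsolvable finite-index normal subgroup membership problem or unsolvable word problem.
   Context: Here $\mathbb{N} = \{1,2,3,\ldots\}$. A function $\mathbb{N}\to\mathbb{N}$ is computable if it is total recursive. That $f$ grows faster than every computable function means: for every computable $g : \mathbb{N} \to \mathbb{N}$, $f(n) > g(n)$ for all sufficiently large $n$. Construction of $B_f$. For a function $f : \mathbb{N} \to \mathbb{N}$, first replace $f$ if necessary by a (pointwise) larger function, so as to have an increasing function, still denoted $f$ in this construction, with $f(n) \geq n$ for all $n$. Fix functions $p, q, d : \mathbb{N} \to \mathbb{N}$ (such functions exist) satisfying, for all $k \in \mathbb{N}$: (i) $p$ is strictly increasing, takes only odd values, and $p(1) = 1$; (ii) $q(k) > 2$ is odd; (iii) $d(k) = p(k) q(k) + 2$; (iv) $d(k)$ is an odd integer greater than $2 \cdot f(4p(k+1) + 4)$; (v) for all $i \leq k$, $p(k+1) q(i) \not\equiv \pm 1, \pm 2 \pmod{d(i)}$. For odd $n \geq 5$ let $\mathrm{Alt}(n)$ be the alternating group on $\{1,\ldots,n\}$, and let $\alpha_n = (1,2,3,\ldots,n)$ and $\beta = (1,2,3)$ in $\mathrm{Alt}(n)$. In the full direct product $G = \prod_{k \in \mathbb{N}} \mathrm{Alt}(d(k))$ let $s = (s_1, s_2, s_3, \ldots)$ with $s_k = \alpha_{d(k)}^{q(k)}$ and let $t = (\beta, \beta, \beta, \ldots)$. Then $B_f = \langle s, t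 \rangle \leq G$. Decision problems. For a finitely generated group $\Gamma$, the finite-index normal subgroup membership problem in $\Gamma$ is solvable if there is an algorithm which, for every element $g \in \Gamma$ and every finite-index normal subgroup $H \lhd \Gamma$, determines in a finite amount of time whether $g \in H$. Here elements of $\Gamma$ are given as words in a fixed finite generating set of $\Gamma$ and its inverses, and $H$ is given by a finite list of words whose images in $\Gamma$ generate $H$ (finite-index subgroups of finitely generated groups are finitely generated); nothing is required of the algorithm on lists that do not generate a finite-index normal subgroup. The word problem for $\Gamma$ is solvable if there is an algorithm deciding whether a given word in a finite generating set and its inverses represents the identity of $\Gamma$. A problem is unsolvable if it is not solvable. *)

(* Defs.v *)
From HB Require Import structures.
From mathcomp Require Import all_boot all_order all_algebra all_fingroup all_solvable.
From mathcomp Require Import mathcomp_extra boolp classical_sets functions cardinality.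

Set Implicit Arguments.
Unset Strict Implicit.
Unset Printing Implicit Defensive.

Local Open Scope classical_set_scope.

(** * Partial recursive functions *)

Inductive recf : nat -> Type :=
| RZero : recf 0
| RSucc : recf 1
| RProj n (i : 'I_n) : recf n
| RComp k n (e : recf k) (es : 'I_k -> recf n) : recf n
| RPrec n (e0 : recf n) (e1 : recf n.+2) : recf n.+1
| RMu n (e : recf n.+1) : recf n.

(* [computes e v y]: the partial function with program [e] is defined at [v],
   with value [y].  In [RPrec], [r] lists the successive values of the
   recursion; the recursion (resp. minimization) variable comes first. *)
Fixpoint computes n (e : recf n) : n.-tuple nat -> nat -> Prop :=
  match e with
  | RZero => fun _ y => y = 0
  | RSucc => fun v y => y = (thead v).+1
  | RProj _ i => fun v y => y = tnth v i
  | RComp k _ e es => fun v y =>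
      exists w : k.-tuple nat,
        (forall i, computes (es i) v (tnth w i)) /\ computes e w y
  | RPrec _ e0 e1 => fun v y =>
      exists r : nat -> nat,
        [/\ computes e0 (behead_tuple v) (r 0),
            forall i, i < thead v ->
              computes e1 (cons_tuple i (cons_tuple (r i) (behead_tuple v)))
                       (r i.+1)
          & y = r (thead v)]
  | RMu _ e => fun v y =>
      computes e (cons_tuple y v) 0 /\
      forall z, z < y -> exists x, computes e (cons_tuple z v) x.+1
  end.

Lemma computes_inj n (e : recf n) v y z :
  computes e v y -> computes e v z -> y = z.
Proof.
elim: e v y z => {n} /=.
- by move=> v y z -> ->.
- by move=> v y z -> ->.
- by move=> n i v y z -> ->.
- move=> k n e IHe es IHes v y z [w [ww wy]] [w' [ww' wz]].
  suff eww' : w = w' by apply: IHe wy _; rewrite eww'.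
  by apply: eq_from_tnth => i; apply: IHes (ww i) (ww' i).
- move=> n e0 IH0 e1 IH1 v y z [r [r0 rS ->]] [r' [r'0 r'S ->]].
  suff H i : i <= thead v -> r i = r' i by exact: H.
  elim: i => [_|i IHi lti]; first exact: IH0 r0 r'0.
  by apply: IH1 (rS _ lti) _; rewrite (IHi (ltnW lti)); exact: r'S.
- move=> n e IHe v y z [y0 yS] [z0 zS].
  case: (ltngtP y z) => // [/zS|/yS] [x xS].
  + by have := IHe _ _ _ y0 xS.
  + by have := IHe _ _ _ z0 xS.
Qed.

(** * Functions on the positive integers

    A function N -> N, where N = {1, 2, ...}, is a [nat -> nat] mapping positive
    numbers to positive numbers; its value at 0 is never used. *)

Definition maps_pos (g : nat -> nat) : Prop := forall n, 0 < n -> 0 < g n.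

Definition computable (g : nat -> nat) : Prop :=
  exists e : recf 1, forall n, 0 < n -> computes e [tuple n] (g n).

Definition outgrows_computable (f : nat -> nat) : Prop :=
  forall g : nat -> nat, maps_pos g -> computable g ->
    exists N, forall n, N <= n -> g n < f n.

(** * Subgroups of a possibly infinite group *)

Section Subgroups.
Variable G : groupType.
Implicit Types (A B H : set G).

Definition is_subgroup H : Prop :=
  [/\ H 1%g, forall x y, H x -> H y -> H (x * y)%g
    & forall x, H x -> H (x^-1)%g].

Definition generated A : set G := smallest is_subgroup A.

Definition normal_in B H : Prop :=
  [/\ is_subgroup H, H `<=` B & forall x h, B x -> H h -> H (h ^ x)%g].

Definition lcosets_in B H : set (set G) :=
  [set [set (x * h)%g | h in H] | x in B].

Definition finite_index_normal B H : Prop :=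
  normal_in B H /\ finite_set (lcosets_in B H).

End Subgroups.

(** * Words *)

(* The letter (i, false) is the i-th generator, (i, true) its inverse. *)
Definition letter n := ('I_n * bool)%type.
Definition word n := seq (letter n).

Definition inv_letter n (x : letter n) : letter n := (x.1, ~~ x.2).

Section Evaluation.
Variables (G : groupType) (n : nat) (a : 'I_n -> G).

Definition eval_letter (x : letter n) : G :=
  (if x.2 then (a x.1)^-1 else a x.1)%g.

Definition eval_word (w : word n) : G := (\prod_(x <- w) eval_letter x)%g.

End Evaluation.

(* Goedel numbers of words and of lists of words. *)
Definition code_word n (w : word n) : nat :=
  CodeSeq.code [seq (x.1 : nat).*2 + x.2 | x : letter n <- w].

Definition code_words n (l : seq (word n)) : nat :=
  CodeSeq.code [seq code_word w | w <- l].

(* The congruence on words whose quotient is the group presented by n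
   generators and the relators R. *)
Inductive presented_eq n (R : seq (word n)) : word n -> word n -> Prop :=
| PresRefl u : presented_eq R u u
| PresSym u v : presented_eq R u v -> presented_eq R v u
| PresTrans u v w :
    presented_eq R u v -> presented_eq R v w -> presented_eq R u w
| PresCancel u v x : presented_eq R (u ++ [:: x; inv_letter x] ++ v) (u ++ v)
| PresRel u v r : r \in R -> presented_eq R (u ++ r ++ v) (u ++ v).

(** * Finite presentability and decision problems for a subgroup B of G *)

Section Problems.
Variables (G : groupType) (B : set G).

Definition generating_family n (a : 'I_n -> G) : Prop :=
  generated (range a) = B.

Definition finitely_presented : Prop :=
  exists n (a : 'I_n -> G) (R : seq (word n)),
    generating_family a /\
    forall u v, eval_word a u = eval_word a v <-> presented_eq R u v.

Definition generated_by_words n (a : 'I_n -> G) (l : seq (word n)) : set G :=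
  generated [set eval_word a u | u in [set` l]].

(* The program [e] may diverge on lists [l] that do not generate a
   finite-index normal subgroup. *)
Definition fin_index_normal_membership_solvable : Prop :=
  exists n (a : 'I_n -> G), generating_family a /\
  exists e : recf 2, forall (w : word n) (l : seq (word n)),
    finite_index_normal B (generated_by_words a l) ->
    exists b : bool,
      computes e [tuple code_word w; code_words l] b /\
      (b <-> generated_by_words a l (eval_word a w)).

Definition word_problem_solvable : Prop :=
  exists n (a : 'I_n -> G), generating_family a /\
  exists e : recf 1, forall w : word n,
    exists b : bool,
      computes e [tuple code_word w] b /\ (b <-> eval_word a w = 1%g).

End Problems.

(** * Full direct products *)

Definition dirprod (I : Type) (T : I -> groupType) : Type := forall i, T i.

Section DirProd.
Variables (I : Type) (T : I -> groupType).

HB.instance Definition _ := gen_eqMixin (dirprod T).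
HB.instance Definition _ := gen_choiceMixin (dirprod T).

Definition dirprod_one : dirprod T := fun i => 1%g.
Definition dirprod_mul (x y : dirprod T) : dirprod T := fun i => (x i * y i)%g.
Definition dirprod_inv (x : dirprod T) : dirprod T := fun i => (x i)^-1%g.

Fact dirprod_mulA : associative dirprod_mul.
Proof. by move=> x y z; apply: functional_extensionality_dep => i; exact: mulgA. Qed.
Fact dirprod_mul1 : left_id dirprod_one dirprod_mul.
Proof. by move=> x; apply: functional_extensionality_dep => i; exact: mul1g. Qed.
Fact dirprod_mulr1 : right_id dirprod_one dirprod_mul.
Proof. by move=> x; apply: functional_extensionality_dep => i; exact: mulg1. Qed.
Fact dirprod_mulV : left_inverse dirprod_one dirprod_inv dirprod_mul.
Proof. by move=> x; apply: functional_extensionality_dep => i; exact: mulVg. Qed.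
Fact dirprod_mulrV : right_inverse dirprod_one dirprod_inv dirprod_mul.
Proof. by move=> x; apply: functional_extensionality_dep => i; exact: mulgV. Qed.

HB.instance Definition _ := isGroup.Build (dirprod T)
  dirprod_mulA dirprod_mul1 dirprod_mulr1 dirprod_mulV dirprod_mulrV.

End DirProd.

(** * The group B_f *)

(* The points 1, ..., n are represented by the elements 0, ..., n - 1 of 'I_n. *)
Definition alpha n : {perm 'I_n} := perm (@ordS_inj n).

(* The 3-cycle 0 -> 1 -> 2 -> 0; it is only meaningful for 3 <= n. *)
Definition beta n : {perm 'I_n} :=
  match n with
  | 0 => 1%g
  | m.+1 => (tperm (inord 0) (inord 1) * tperm (inord 0) (inord 2))%g
  end.

Lemma alphaE n (i : 'I_n) : alpha n i = i.+1 %% n :> nat.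
Proof. by rewrite permE. Qed.

Lemma betaE n (i : 'I_n) : 3 <= n ->
  beta n i = (if i < 3 then i.+1 %% 3 else i) :> nat.
Proof.
case: n i => // m i m2; have m1 := ltnW m2.
have ne j k : j < 3 -> k < 3 -> j != k -> inord j != inord k :> 'I_m.+1.
  move=> lt_j lt_k; apply: contra => /eqP/(congr1 val) /=.
  by rewrite !inordK ?(leq_trans lt_j) ?(leq_trans lt_k) // => ->.
rewrite /= permM; case: ifP => [|/negbT]; last first.
  rewrite -leqNgt => i3.
  have D j : j < 3 -> inord j != i :> 'I_m.+1.
    move=> j3; apply/negP => /eqP Ej; move: i3.
    by rewrite -Ej inordK ?(leq_trans j3) // leqNgt j3.
  by rewrite !tpermD ?D.
move=> i3; have [j [j3 ->]] : exists j, j < 3 /\ i = inord j.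
  by exists i; rewrite inord_val.
rewrite [in RHS]inordK ?(leq_trans j3) //; case: j j3 => [|[|[|]]] //= _.
- by rewrite tpermL tpermD ?ne // inordK.
- by rewrite tpermR tpermL inordK.
- by rewrite [tperm _ (inord 1) _]tpermD ?ne // tpermR inordK.
Qed.

Lemma alpha_Alt n : odd n -> alpha n \in ('Alt_('I_n))%g.
Proof.
move=> odd_n; rewrite Alt_even.
have an1 : (alpha n ^+ n = 1)%g.
  have H m (i : 'I_n) : ((alpha n ^+ m)%g i = (i + m) %% n :> nat).
    elim: m => [|m IHm]; first by rewrite expg0 perm1 addn0 modn_small.
    by rewrite expgSr permM alphaE IHm -addn1 modnDml addn1 addnS.
  by apply/permP => i; apply: val_inj; rewrite /= H perm1 modnDr modn_small.
have := congr1 (@odd_perm _) an1; rewrite odd_perm1.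
have -> m : odd_perm (alpha n ^+ m)%g = odd m && alpha n.
  elim: m => [|m IHm]; first by rewrite expg0 odd_perm1.
  by rewrite expgSr odd_permM IHm /=; case: (odd m); case: (odd_perm _).
by rewrite odd_n /= => ->.
Qed.

Lemma beta_Alt n : 3 <= n -> beta n \in ('Alt_('I_n))%g.
Proof.
case: n => // m m2; rewrite Alt_even odd_permM !odd_tperm.
by rewrite -!val_eqE /= !inordK // (leq_trans _ m2).
Qed.

(* Admissible choices in the construction; F is the increasing function that
   replaces f. *)
Record Bf_data (f F p q d : nat -> nat) : Prop := {
  Bf_F_ge_f : forall n, 0 < n -> f n <= F n;
  Bf_F_incr : forall m n, 0 < m -> m <= n -> F m <= F n;
  Bf_F_ge_id : forall n, 0 < n -> n <= F n;
  Bf_p_incr : forall k l, 0 < k -> k < l -> p k < p l;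
  Bf_p_odd : forall k, 0 < k -> odd (p k);
  Bf_p1 : p 1 = 1;
  Bf_q_gt2 : forall k, 0 < k -> 2 < q k;
  Bf_q_odd : forall k, 0 < k -> odd (q k);
  Bf_dE : forall k, 0 < k -> d k = p k * q k + 2;
  Bf_d_odd : forall k, 0 < k -> odd (d k);
  Bf_d_gt : forall k, 0 < k -> 2 * F (4 * p k.+1 + 4) < d k;
  Bf_pq_mod : forall i k, 0 < i -> i <= k ->
    forall c : int, c \in [:: 1; -1; 2; -2]%R ->
      ((p k.+1 * q i)%:Z != c %[mod (d i)%:Z])%Z
}.

Section Bf.
Variables q d : nat -> nat.

(* N = {1, 2, ...}: the factor of index k : nat is Alt(d(k + 1)). *)
Definition prod_Alt : groupType :=
  dirprod (fun k => [subg ('Alt_('I_(d k.+1)))%g] : groupType).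

(* [subg _] is the projection onto the subgroup; see [Bf_sE] and [Bf_tE]. *)
Definition Bf_s : prod_Alt := fun k => subg _ (alpha (d k.+1) ^+ q k.+1)%g.
Definition Bf_t : prod_Alt := fun k => subg _ (beta (d k.+1)).

Lemma Bf_sE k : odd (d k.+1) ->
  sgval (Bf_s k) = (alpha (d k.+1) ^+ q k.+1)%g.
Proof. by move=> dk; rewrite subgK ?groupX ?alpha_Alt. Qed.

Lemma Bf_tE k : 3 <= d k.+1 -> sgval (Bf_t k) = beta (d k.+1).
Proof. by move=> dk; rewrite subgK ?beta_Alt. Qed.

Definition Bf : set prod_Alt := generated [set Bf_s; Bf_t].

End Bf.

Arguments Bf : clear implicits.

(* Main.v *)
From HB Require Import structures.
From mathcomp Require Import all_boot all_order all_algebra all_fingroup all_solvable.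
From mathcomp Require Import boolp classical_sets.
From mathcomp Require Import zify ring.
Require Import Defs.

(** Put c_j = [t, t^(s^j)]. Since s acts on the k-th factor as a rotation by
    q(k), the permutations t and t^(s^j) have disjoint supports there as soon as
    j < p(k). So c_j lives in finitely many factors and some positive power of s
    commutes with it. On the other hand s^p(k) acts on the k-th factor as a
    rotation by -2, and then c_p(k) is a 3-cycle there which only the powers of
    s divisible by d(k) centralize.

    Unsolvable word problem: given a solution, one computes by unbounded search
    the least M > 0 such that s^M commutes with c_j. At j = p(k) this M is at
    least d(k) > f(p(k)), contrary to the growth of f.

    No finite presentation: a word of length m cannot distinguish the rotation
    models (Sym(d), alpha^q, beta) with d large compared to m q, all of which
    look like the lamplighter group Z/3 wr Z up to radius m. Hence, if the group
    were finitely presented, the subgroup <alpha^q', beta> of Sym(p'q' + 2) would be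
    a quotient for every large p' and every odd q' > 2. Some s^M with M > 0
    commutes with c_p' in the group, hence in these quotients, which forces
    p'q' + 2 <= M for all q'. *)

Set Implicit Arguments.
Unset Strict Implicit.
Unset Printing Implicit Defensive.

Import GRing.Theory.

(** * Rotations and the 3-cycle on Z/(D + 2), its points being images of integers *)

Section CyclicModel.
Local Open Scope ring_scope.
Variable D : nat.
Local Notation pt z := ((z : int)%:~R : 'I_D.+2).

Lemma pt_eq0 (z : int) : pt z = 0 -> (`|z| < D.+2)%N -> z = 0.
Proof.
have nat_eq0 (n : nat) : (n%:R = 0 :> 'I_D.+2) -> (n < D.+2)%N -> n = 0%N.
  by rewrite Zp_nat => /(congr1 val) /= + ltn; rewrite modn_small.
case: z => n; first by move=> /nat_eq0 + /[dup]=> /[apply] ->.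
rewrite NegzE mulrNz => /eqP; rewrite oppr_eq0 => /eqP /nat_eq0 H.
by rewrite abszN => /H.
Qed.

Lemma pt_inj (z z' : int) : pt z = pt z' -> (`|z - z'|%N < D.+2)%N -> z = z'.
Proof.
move=> e l; apply/eqP; rewrite -subr_eq0; apply/eqP/(pt_eq0 _ l).
by rewrite mulrzBr e subrr.
Qed.

Lemma pt_surj (y : 'I_D.+2) : exists z, y = pt z.
Proof. by exists (Posz y); rewrite -pmulrn Zp_nat valZpK. Qed.

Lemma alpha_pt z : alpha D.+2 (pt z) = pt (z + 1).
Proof.
apply: val_inj; rewrite /= alphaE /= rmorphD /=.
by rewrite -[RHS]/((_ + 1 %% D.+2) %% D.+2)%N modnDmr addn1.
Qed.

Lemma alphaX_pt n z : (alpha D.+2 ^+ n)%g (pt z) = pt (z + n%:Z).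
Proof.
elim: n => [|n IHn]; first by rewrite expg0 perm1 addr0.
by rewrite expgSr permM IHn alpha_pt -addrA intS [1 + _]addrC.
Qed.

Lemma alphaX_order : (alpha D.+2 ^+ D.+2 = 1)%g.
Proof.
apply/permP => y; have [z ->] := pt_surj y.
rewrite alphaX_pt perm1 rmorphD /= -[X in _ + X]/(D.+2%:R)
  -[D.+2 in LHS]/(Zp_trunc D.+2).+2.
by rewrite (@pchar_Zp D.+2) // addr0.
Qed.

Hypothesis D3 : (0 < D)%N.

Lemma beta_pt (a : nat) : (a < 3)%N -> beta D.+2 (pt a) = pt (a.+1 %% 3)%N.
Proof.
move=> a3; apply: ord_inj; rewrite betaE // -!pmulrn !Zp_nat.
have e1 : (inZp 1 : 'I_D.+2) = 1%N :> nat by exact: modn_small.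
have e2 : (inZp 2 : 'I_D.+2) = 2%N :> nat by exact: modn_small.
by case: a a3 => [|[|[|]]] // _; rewrite ?e1 ?e2.
Qed.

Lemma beta_fix (y : 'I_D.+2) :
  (forall a : nat, (a < 3)%N -> y <> pt a) -> beta D.+2 y = y.
Proof.
move=> ny; apply: ord_inj; rewrite betaE //; case: ifP => // y3.
by case: (ny y y3); rewrite -pmulrn Zp_nat valZpK.
Qed.

End CyclicModel.

Lemma perm_commute_disjoint (T : finType) (u v : {perm T}) :
  (forall y, u y = y \/ v y = y) -> commute u v.
Proof.
move=> uv; apply/permP => y; rewrite !permM.
have fix_iter (f g : {perm T}) : (forall z, f z = z \/ g z = z) ->
    f y = y -> g (f y) = f (g y).
  move=> fg fy; rewrite fy; case: (fg (g y)) => [-> //|/perm_inj gy].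
  by rewrite gy fy.
case: (uv y) => [|vy]; first exact: fix_iter.
by apply/esym; apply: fix_iter => // z; case: (uv z); [right|left].
Qed.

Lemma perm_commgE (T : finType) (u v : {perm T}) z : [~ u, v]%g (u (v z)) = v (u z).
Proof. by rewrite -[RHS]permM [(u * v)%g]commgC !permM. Qed.

(** * Commutators of [t] with its conjugates by powers of [s] in a rotation model *)

Section CyclicModelCommutators.
Local Open Scope ring_scope.
Variables (D p q : nat).
Hypotheses (q2 : (2 < q)%N) (dE : D.+2 = (p * q + 2)%N) (D3 : (3 < D)%N).
Local Notation pt z := ((z : int)%:~R : 'I_D.+2).
Local Notation s := (alpha D.+2 ^+ q)%g.
Local Notation t := (beta D.+2).

Let D0 : (0 < D)%N. Proof. exact: leq_trans D3. Qed.

Lemma model_shift j z : (s ^+ j)%g (pt z) = pt (z + (q * j)%N%:Z).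
Proof. by rewrite -expgM alphaX_pt. Qed.

(** For j > 0 the supports {0, 1, 2} and {qj, qj + 1, qj + 2} are disjoint, even around the circle:
    qj lies between q > 2 and pq - q. *)
Lemma model_comm_trivial j : (j < p)%N -> [~ t, t ^ (s ^+ j)]%g = 1%g.
Proof.
move=> jp; apply/eqP/commgP; case: (posnP j) => [->|j0].
  by rewrite expg0 conjg1.
apply: perm_commute_disjoint => y.
case: (pselect (exists2 a : nat, (a < 3)%N & y = pt a)) => [[a a3 ->]|ny].
  right; have [z ez] := pt_surj ((s ^+ j)^-1%g (pt a)).
  have -> : pt a = (s ^+ j)%g (pt z) by rewrite -ez permKV.
  rewrite permJ beta_fix // => b b3 eb.
  have : pt a = (s ^+ j)%g (pt b) by rewrite -eb -ez permKV.
  rewrite model_shift => /pt_inj.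
  have : (q * j <= q * p - q)%N by nia.
  nia.
left; apply: beta_fix => // a a3 ya; apply: ny; by exists a.
Qed.

(** The shift by pq is the shift by -2 modulo [D.+2]. So [y] is the 3-cycle -2, -1, 0 and [c] comes
    out as the 3-cycle 0, -2, 1, with which no nontrivial rotation commutes. *)
Lemma model_comm_order M :
  (0 < M)%N -> coprime D.+2 q -> commute (s ^+ M)%g [~ t, t ^ (s ^+ p)]%g ->
  (D.+2 <= M)%N.
Proof.
move=> M0 cop; set y := (t ^ _)%g; set c := commg _ _ => comm.
have pt_sub z : pt z = pt (z - D.+2%:Z).
  rewrite mulrzBr -pmulrn -[X in _ = _ - X]/((Zp_trunc D.+2).+2%:R).
  by rewrite (@pchar_Zp D.+2) // subr0.
have gz z : (s ^+ p)%g (pt z) = pt (z - 2).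
  by rewrite model_shift pt_sub; congr (pt _); lia.
have yz z : y (pt (z - 2)) = (s ^+ p)%g (t (pt z)) by rewrite -gz permJ.
have cE z : c (t (y z)) = y (t z) by exact: perm_commgE.
have neq z z' : (`|(z - z')%R| < 6)%N -> z != z' -> pt z <> pt z'.
  move=> lt_zz' /eqP ne /pt_inj e; apply: ne; apply: e; lia.
have tfix z : pt z <> pt 0 -> pt z <> pt 1 -> pt z <> pt 2 -> t (pt z) = pt z.
  by move=> z0 z1 z2; apply: beta_fix => // -[|[|[|]]].
have t0 : t (pt 0) = pt 1 by exact: (beta_pt D0 (a := 0)).
have t1 : t (pt 1) = pt 2 by exact: (beta_pt D0 (a := 1)).
have t2 : t (pt 2) = pt 0 by exact: (beta_pt D0 (a := 2)).
have y0 : y (pt (-2)) = pt (-1) by rewrite (yz 0) t0 gz.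
have y1 : y (pt (-1)) = pt 0 by rewrite (yz 1) t1 gz.
have y2 : y (pt 0) = pt (-2) by rewrite (yz 2) t2 gz.
have yfix z : pt z <> pt (-2) -> pt z <> pt (-1) -> pt z <> pt 0 -> y (pt z) = pt z.
  move=> z0 z1 z2; have -> : pt z = pt (z + 2 - 2) by congr (pt _); ring.
  rewrite yz tfix ?gz // => /(congr1 (fun u => u - pt 2)) /=.
  - by rewrite -!mulrzBr => e; apply: z0; rewrite -e; congr (pt _); ring.
  - by rewrite -!mulrzBr => e; apply: z1; rewrite -e; congr (pt _); ring.
  - by rewrite -!mulrzBr => e; apply: z2; rewrite -e; congr (pt _); ring.
have c0 : c (pt 0) = pt (-2) by rewrite -y2 -t2 -cE yfix ?t2 //; exact: neq.
have tm2 : t (pt (-2)) = pt (-2) by apply: tfix; exact: neq.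
have tm1 : t (pt (-1)) = pt (-1) by apply: tfix; exact: neq.
have yp1 : y (pt 1) = pt 1 by apply: yfix; exact: neq.
have yp2 : y (pt 2) = pt 2 by apply: yfix; exact: neq.
have cm2 : c (pt (-2)) = pt 1 by rewrite -yp1 -t0 -cE y2 tm2.
have c1 : c (pt 1) = pt 0 by rewrite -y1 -tm1 -cE y1 t0.
have cfix z : pt z <> pt 0 -> pt z <> pt 1 -> pt z <> pt (-2) -> c (pt z) = pt z.
  move=> z0 z1 z2; case: (pselect (pt z = pt 2)) => [->|z3].
    by rewrite -[RHS]yp2 -[in RHS]t1 -cE yp1 t1.
  case: (pselect (pt z = pt (-1))) => [->|z4].
    by rewrite -[RHS]y0 -[in RHS]tm2 -cE y0 tm1.
  by rewrite -[RHS]yfix // -[in RHS](tfix z) // -cE yfix ?tfix.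
(* [s ^+ M] is the shift by [v]. Commutation at 0 shows that [c] sends v to v - 2, so v is moved;
   but v = 1 would force 0 = -1 and v = -2 would force 1 = -4, impossible modulo [D.+2], which is at
   least 6. Hence v = 0, and coprimality makes [D.+2] divide [M]. *)
pose v := (q * M)%N%:Z.
have cv z : c (pt (z + v)) = (s ^+ M)%g (c (pt z)).
  by rewrite -model_shift -permM comm permM.
have pv z : (s ^+ M)%g (pt z) = pt (z + v) by rewrite model_shift.
have := cv 0; have := cv 1; have := cv (-2); rewrite c0 c1 cm2 !pv add0r.
case: (pselect (pt v = pt 0)) => [v0 _ _ _|v0].
  have : (D.+2 %| q * M)%N.
    by move: v0; rewrite -pmulrn Zp_nat => /(congr1 val) /= e; rewrite /dvdn e.
  by rewrite Gauss_dvdr // => /dvdn_leq; apply.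
case: (pselect (pt v = pt 1)) => [v1 _ _|v1].
  rewrite v1 c1 mulrzDr v1 -mulrzDr => e; by case: (neq _ _ _ _ e).
case: (pselect (pt v = pt (-2))) => [v2 _ _|v2 _ _].
  rewrite v2 cm2 mulrzDr v2 -mulrzDr => e; by case: (neq _ _ _ _ e).
rewrite cfix // => /(congr1 (fun u => u - pt v)); rewrite -!mulrzBr subrr addrK => e.
by case: (neq _ _ _ _ e).
Qed.

End CyclicModelCommutators.

Section Words.
Variables (G : groupType) (n : nat) (a : 'I_n -> G).

Definition inv_word (w : word n) : word n := rev (map (@inv_letter n) w).

Lemma eval_word_cons x w : eval_word a (x :: w) = (eval_letter a x * eval_word a w)%g.
Proof. exact: big_cons. Qed.

Lemma eval_word_nil : eval_word a [::] = 1%g.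
Proof. exact: big_nil. Qed.

Lemma eval_word_cat u v : eval_word a (u ++ v) = (eval_word a u * eval_word a v)%g.
Proof. exact: big_cat. Qed.

Lemma eval_inv_letter x : eval_letter a (inv_letter x) = (eval_letter a x)^-1%g.
Proof. by case: x => i [] //=; rewrite /eval_letter /= invgK. Qed.

Lemma eval_inv_word w : eval_word a (inv_word w) = (eval_word a w)^-1%g.
Proof.
elim: w => [|x w IHw]; first by rewrite /inv_word eval_word_nil invg1.
rewrite /inv_word /= rev_cons -cats1 eval_word_cat IHw !eval_word_cons eval_word_nil.
by rewrite mulg1 eval_inv_letter invgM.
Qed.

(** The values of words form a subgroup containing [A]. *)
Lemma generated_eval_word (A : set G) x :
  generated A x -> (A `<=` range a)%classic -> exists w, eval_word a w = x.
Proof.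
move=> Ax sAa; suff /Ax[w _ <-] : is_subgroup (range (eval_word a)) /\
    (A `<=` range (eval_word a))%classic by exists w.
split; last first.
  move=> y /sAa [i _ <-]; exists [:: (i, false)] => //.
  by rewrite eval_word_cons eval_word_nil mulg1.
split; first by exists [::] => //; rewrite eval_word_nil.
- by move=> _ _ [u _ <-] [v _ <-]; exists (u ++ v) => //; rewrite eval_word_cat.
- by move=> _ [u _ <-]; exists (inv_word u) => //; rewrite eval_inv_word.
Qed.

(** Von Dyck: an assignment of the generators that kills the relators factors through the presented
    group. *)
Lemma presented_eq_eval (R : seq (word n)) u v :
  (forall r, r \in R -> eval_word a r = 1%g) -> presented_eq R u v ->
  eval_word a u = eval_word a v.
Proof.
move=> R1; elim=> {u v} //.
- by move=> u v w _ -> _ ->.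
- move=> u v x; rewrite !eval_word_cat !eval_word_cons eval_word_nil mulg1.
  by rewrite eval_inv_letter mulgV mul1g.
- by move=> u v r /R1 r1; rewrite !eval_word_cat r1 mul1g.
Qed.

End Words.

Lemma eval_word_morph (G H : groupType) (f : UMagmaMorphism.type G H)
    n (a : 'I_n -> G) w :
  f (eval_word a w) = eval_word (f \o a) w.
Proof.
rewrite /eval_word gmulf_prod; apply: eq_bigr => x _.
by rewrite /eval_letter; case: (x.2); rewrite ?gmulfV.
Qed.

Section Substitution.
Variables (n m : nat) (A : 'I_n -> word m).

Definition subst_letter (x : letter n) : word m :=
  if x.2 then inv_word (A x.1) else A x.1.

Definition subst_word (w : word n) : word m := flatten (map subst_letter w).

Lemma eval_subst_word (G : groupType) (b : 'I_m -> G) (w : word n) :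
  eval_word b (subst_word w) = eval_word (fun i => eval_word b (A i)) w.
Proof.
elim: w => [|[i e] w IHw]; first by rewrite !eval_word_nil.
rewrite /subst_word /= eval_word_cat IHw eval_word_cons; congr (_ * _)%g.
by rewrite /subst_letter /eval_letter; case: e => //=; rewrite eval_inv_word.
Qed.

End Substitution.

Definition pair_family (T : Type) (x y : T) (i : 'I_2) : T :=
  if val i is 0 then x else y.

Lemma range_pair_family (T : Type) (x y : T) :
  (range (pair_family x y) = [set x; y])%classic.
Proof.
apply/seteqP; split => [_ [[[|i] ?] _ <-]|_ [] ->]; [by left|by right|..].
- by exists ord0.
- by exists ord_max.
Qed.

(** * Rotation models compared with the lamplighter group Z/3 wr Z *)

Section LampWords.
Local Open Scope ring_scope.

(* The state (a, j) is the lamp position j in Z together with a value a in Z/3;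
   it stands for the point a + j q of a rotation model, see [site] below. *)
Definition lamp_step (u : nat * int) (x : letter 2) : nat * int :=
  if val x.1 is 0%N then (u.1, if x.2 then u.2 - 1 else u.2 + 1)
  else if u.2 == 0 then ((if x.2 then u.1.+2 else u.1.+1) %% 3, u.2)%N else u.

Definition lamp_act (w : word 2) (u : nat * int) : nat * int := foldl lamp_step u w.

Fixpoint s_exponent (w : word 2) : int :=
  if w is x :: w' then
    (if val x.1 is 0%N then if x.2 then -1 else 1 else 0) + s_exponent w'
  else 0.

Lemma lamp_act2 w u : (lamp_act w u).2 = u.2 + s_exponent w.
Proof.
elim: w u => [|[[[|i] lti] e] w IHw] u; first by rewrite addr0.
  by rewrite [LHS]IHw /=; case: e; rewrite addrA.
by rewrite [LHS]IHw /lamp_step /=; case: ifP; rewrite add0r.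
Qed.

Lemma lamp_act1 w u : (u.1 < 3)%N -> ((lamp_act w u).1 < 3)%N.
Proof.
elim: w u => [|[[[|i] lti] e] w IHw] u u3 //; apply: IHw => //.
by rewrite /lamp_step /=; case: ifP => //; rewrite ltn_mod.
Qed.

Lemma s_exponent_le w : (`|s_exponent w| <= size w)%N.
Proof. by elim: w => [|[[[|i] lti] []] w IHw] //=; lia. Qed.

Variables (D q m : nat).
Hypotheses (q2 : (2 < q)%N) (mqD : (2 * m * q < D)%N).
Local Notation pt z := ((z : int)%:~R : 'I_D.+2).
Local Notation s := (alpha D.+2 ^+ q)%g.
Local Notation t := (beta D.+2).
Local Notation site u := (pt (u.1%:Z + u.2 * q%:Z)).

(** Blocks {jq, jq + 1, jq + 2} do not overlap since q > 2, and [2 * m * q < D] prevents wrapping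
    around the circle. *)
Lemma site_inj (u v : nat * int) : (u.1 < 3)%N -> (v.1 < 3)%N ->
  (`|(u.2 - v.2)%R| <= 2 * m)%N -> site u = site v -> u = v.
Proof.
case: u v => [a j] [b k] /= a3 b3 jk.
have le_jkq : (`|((j - k) * q%:Z)%R| <= 2 * m * q)%N by rewrite abszM leq_mul2r jk orbT.
move=> /pt_inj e; have {e} : a%:Z + j * q%:Z = b%:Z + k * q%:Z by apply: e; lia.
have [-> e|ne] := eqVneq j k; first by congr pair; lia.
have : (q <= `|((j - k) * q%:Z)%R|)%N.
  by rewrite abszM leq_pmull // absz_gt0 subr_eq0.
lia.
Qed.

Lemma s_letter z (e : bool) i :
  eval_letter (pair_family s t) (@Ordinal 2 0 i, e) (pt z) =
    pt (z + if e then - q%:Z else q%:Z).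
Proof.
case: e; rewrite /eval_letter /=; last by rewrite alphaX_pt.
by apply: (canLR (permK _)); rewrite alphaX_pt subrK.
Qed.

Lemma t_letter_fix y (e : bool) k i : (forall a : nat, (a < 3)%N -> y <> pt a) ->
  eval_letter (pair_family s t) (@Ordinal 2 k.+1 i, e) y = y.
Proof.
move=> /(beta_fix (leq_ltn_trans (leq0n _) mqD)) ty; rewrite /eval_letter /=.
by case: e => //; apply: (canLR (permK _)); rewrite ty.
Qed.

Lemma site_letter u x : (u.1 < 3)%N -> (`|u.2| <= 2 * m)%N ->
  eval_letter (pair_family s t) x (site u) = site (lamp_step u x).
Proof.
case: u => a j; case: x => -[[|k] i] e /= a3 jm.
  by rewrite s_letter; congr (pt _); case: e => /=; ring.
rewrite /lamp_step /=; have [->|j0] := eqVneq j 0; last first.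
  apply: t_letter_fix => b b3 ab.
  suff [_ j0'] : (a, j) = (b, 0) by rewrite j0' eqxx in j0.
  by apply: site_inj; rewrite /= ?subr0 ?mul0r ?addr0.
rewrite /= mul0r !addr0; have D0 := leq_ltn_trans (leq0n _) mqD.
case: e; rewrite /eval_letter /=; last exact: beta_pt.
apply: (canLR (permK _)); rewrite beta_pt ?ltn_mod //; congr (pt (Posz _)).
by case: a a3 => [|[|[|]]].
Qed.

Lemma site_word w u : (u.1 < 3)%N -> (`|u.2| + size w <= 2 * m)%N ->
  eval_word (pair_family s t) w (site u) = site (lamp_act w u).
Proof.
elim: w u => [|x w IHw] u u3 um; first by rewrite eval_word_nil perm1.
rewrite eval_word_cons permM site_letter //;
  last by apply: leq_trans um; exact: leq_addr.
apply: IHw; first exact: (@lamp_act1 [:: x]).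
have := lamp_act2 [:: x] u; rewrite [lamp_act _ _]/= => ->.
have := s_exponent_le [:: x]; move: um; rewrite /=; lia.
Qed.

(** Such a point cannot reach {0, 1, 2} within [n] letters, so only the shifts act on it. In the
    induction each [s] letter costs one unit of [n]. *)
Lemma far_word w z n : (size w <= n)%N -> (n <= 2 * m)%N ->
  (forall u, (u.1 < 3)%N -> (`|u.2| <= n)%N -> pt z <> site u) ->
  eval_word (pair_family s t) w (pt z) = pt (z + s_exponent w * q%:Z).
Proof.
elim: w z n => [|[[[|k] i] e] w IHw] z n /= sz nm far.
- by rewrite eval_word_nil perm1 mul0r addr0.
- rewrite eval_word_cons permM s_letter (IHw _ n.-1); [|lia|lia|].
    by congr (pt _); case: e => /=; ring.
  case=> a j /= a3 jn /(congr1 (fun y => y - pt (if e then - q%:Z else q%:Z))).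
  rewrite -!mulrzBr addrK => ez; apply: (far (a, j + if e then 1 else -1) a3) => /=.
    by case: (e); lia.
  by rewrite ez; congr (pt _); case: (e); ring.
- rewrite eval_word_cons permM t_letter_fix; last first.
    by move=> a a3; have := far (a, 0) a3 isT; rewrite mul0r addr0.
  by rewrite add0r; apply: (IHw _ n) => //; exact: ltnW.
Qed.

(** The criterion involves neither [D] nor [q], so it transfers between models. For its sufficiency,
    a point is either a site at distance at most [m] or is merely shifted by [s_exponent w] times q,
    that is by 0. *)
Lemma lamp_actP w : (size w <= m)%N ->
  eval_word (pair_family s t) w = 1%g <->
  (s_exponent w = 0 /\ forall u, (u.1 < 3)%N -> (`|u.2| <= m)%N -> lamp_act w u = u).
Proof.
move=> wm; split=> [w1|[e0 act1]].
  have act1 u : (u.1 < 3)%N -> (`|u.2| <= m)%N -> lamp_act w u = u.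
    move=> u3 um; apply: site_inj => //; first exact: lamp_act1.
      by rewrite lamp_act2; have := s_exponent_le w; lia.
    by rewrite -site_word ?w1 ?perm1 //; lia.
  split=> //; have := lamp_act2 w (0%N, 0).
  by rewrite act1 //= add0r.
apply/permP => y; rewrite perm1; have [z ->] := pt_surj y.
have [[u [u3 um ->]]|far] :=
  pselect (exists u, [/\ u.1 < 3, `|u.2| <= m & pt z = site u]%N).
  by rewrite site_word ?act1 //; lia.
rewrite (@far_word w z m wm) ?e0 ?mul0r ?addr0 //; first by lia.
by move=> u u3 um zu; apply: far; exists u.
Qed.

End LampWords.

Lemma model_words_agree m q q' D D' (w : word 2) :
  2 < q -> 2 < q' -> 2 * m * q < D -> 2 * m * q' < D' -> size w <= m ->
  eval_word (pair_family (alpha D.+2 ^+ q)%g (beta D.+2)) w = 1%g ->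
  eval_word (pair_family (alpha D'.+2 ^+ q')%g (beta D'.+2)) w = 1%g.
Proof.
move=> q2 q'2 Dq D'q' wm /(lamp_actP q2 Dq wm) w1.
exact/(lamp_actP q'2 D'q' wm).
Qed.

(** * Recursive functions on codes of words *)

Definition recursive n (f : n.-tuple nat -> nat) : Prop :=
  exists e : recf n, forall v, computes e v (f v).

Definition recursive1 (g : nat -> nat) : Prop :=
  exists e : recf 1, forall c, computes e [tuple c] (g c).

Lemma recursive_proj n (i : 'I_n) : recursive (fun v => tnth v i).
Proof. by exists (RProj i). Qed.

Lemma recursive1_of g : recursive (fun v : 1.-tuple nat => g (thead v)) -> recursive1 g.
Proof. by case=> e eP; exists e => c; exact: eP. Qed.

Lemma computes_comp1 n (e : recf 1) (e' : recf n) v x y :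
  computes e' v x -> computes e [tuple x] y -> computes (RComp e (fun=> e')) v y.
Proof. by move=> e'x ey; exists [tuple x]; split => // i; rewrite (ord1 i). Qed.

Lemma recursive_comp1 n g (f : n.-tuple nat -> nat) :
  recursive1 g -> recursive f -> recursive (fun v => g (f v)).
Proof.
move=> [e eP] [e' e'P]; exists (RComp e (fun=> e')) => v.
exact: computes_comp1 (e'P v) (eP _).
Qed.

Lemma recursive1_succ : recursive1 succn.
Proof. by exists RSucc. Qed.

Lemma recursive_const n c : recursive (fun _ : n.+1.-tuple nat => c).
Proof.
elim: c => [|c IHc]; last exact: recursive_comp1 recursive1_succ IHc.
by exists (RComp RZero (fun=> RProj ord0)) => v; exists [tuple]; split => // -[].
Qed.

Lemma recursive_iter n g (k f : n.-tuple nat -> nat) :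
  recursive1 g -> recursive k -> recursive f -> recursive (fun v => iter (k v) g (f v)).
Proof.
move=> [eg egP] [ek ekP] [ef efP].
(* The step program receives the counter, the previous value and the parameter, in this order;
   [inord 1] selects the previous value. *)
exists (RComp (RPrec (RProj (ord0 : 'I_1)) (RComp eg (fun=> RProj (inord 1 : 'I_3))))
  (fun i : 'I_2 => if val i is 0 then ek else ef)) => v.
exists [tuple k v; f v]; split.
  by case=> -[|[|i]] //= lti; rewrite (tnth_nth 0) /=.
exists (fun i => iter i g (f v)); split=> // i _; apply: computes_comp1 (egP _).
by rewrite /= (tnth_nth 0) /= inordK.
Qed.

Lemma recursive1_double : recursive1 double.
Proof.
apply: recursive1_of; have -> : (fun v : 1.-tuple nat => (thead v).*2) =
    (fun v => iter (thead v) (fun c => c.+2) 0).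
  by apply/funext => v; elim: (thead v) => //= n <-; rewrite doubleS.
apply: recursive_iter; [|exact: recursive_proj|exact: recursive_const].
apply: recursive1_of; do 2![apply: (recursive_comp1 recursive1_succ)].
exact: recursive_proj.
Qed.

(** If [c] is the [CodeSeq.code] of a list, this is the code of the list with [x] put in front. *)
Definition push_code (x c : nat) : nat := 2 ^ x * c.*2.+1.

Lemma recursive1_push_code x : recursive1 (push_code x).
Proof.
apply: recursive1_of; have -> : (fun v : 1.-tuple nat => push_code x (thead v)) =
    (fun v => iter x double (thead v).*2.+1).
  apply/funext => v; rewrite /push_code; elim: x => [|x]; first by rewrite mul1n.
  by rewrite expnS -mulnA mul2n /= => ->.
apply: (recursive_iter recursive1_double (recursive_const _ _)).
apply: (recursive_comp1 recursive1_succ); apply: (recursive_comp1 recursive1_double).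
exact: recursive_proj.
Qed.

Definition push_word n (u : word n) (c : nat) : nat :=
  foldr (fun x : letter n => push_code ((x.1 : nat).*2 + x.2)) c u.

Lemma code_word_cat n (u w : word n) : code_word (u ++ w) = push_word u (code_word w).
Proof. by elim: u => //= x u IHu; rewrite -IHu. Qed.

Lemma recursive1_push_word n (u : word n) : recursive1 (push_word u).
Proof.
apply: recursive1_of; elim: u => [|x u IHu]; first exact: recursive_proj.
exact: (recursive_comp1 (recursive1_push_code _) IHu).
Qed.

(* A block is a word together with an exponent, which is either 1 or one of
   the k parameters. *)
Section Blocks.
Variables k n : nat.
Definition block := (word n * option 'I_k)%type.
Implicit Types (bs : seq block) (v : k.-tuple nat).

Definition expand v bs : word n :=
  flatten [seq flatten (nseq (if b.2 is Some i then tnth v i else 1) b.1) | b <- bs].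

Definition inv_blocks bs : seq block := rev [seq (inv_word b.1, b.2) | b : block <- bs].

Definition comm_blocks bs bs' : seq block :=
  inv_blocks bs ++ inv_blocks bs' ++ bs ++ bs'.

Section Eval.
Variables (G : groupType) (a : 'I_n -> G).

Lemma eval_expand_cat v bs bs' :
  eval_word a (expand v (bs ++ bs')) =
  (eval_word a (expand v bs) * eval_word a (expand v bs'))%g.
Proof. by rewrite /expand map_cat flatten_cat eval_word_cat. Qed.

Lemma eval_power u m : eval_word a (flatten (nseq m u)) = (eval_word a u ^+ m)%g.
Proof.
by elim: m => [|m IHm]; rewrite ?eval_word_nil //= eval_word_cat IHm expgS.
Qed.

Lemma eval_expand_block v b :
  eval_word a (expand v [:: b]) =
  (eval_word a b.1 ^+ (if b.2 is Some i then tnth v i else 1))%g.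
Proof. by rewrite /expand /= cats0 eval_power. Qed.

Lemma eval_expand_inv v bs :
  eval_word a (expand v (inv_blocks bs)) = (eval_word a (expand v bs))^-1%g.
Proof.
elim: bs => [|b bs IHbs]; first by rewrite /expand /= eval_word_nil invg1.
rewrite /inv_blocks /= rev_cons -cats1 eval_expand_cat IHbs.
by rewrite (eval_expand_cat v [:: b]) invgM !eval_expand_block eval_inv_word expVgn.
Qed.

Lemma eval_expand_comm v bs bs' :
  eval_word a (expand v (comm_blocks bs bs')) =
  [~ eval_word a (expand v bs), eval_word a (expand v bs')]%g.
Proof.
by rewrite /comm_blocks !eval_expand_cat !eval_expand_inv commgEl conjgE !mulgA.
Qed.

End Eval.
End Blocks.

(** Blocks are prepended starting from the last one; an exponent becomes an iteration of [push_word]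
    on codes. *)
Lemma recursive_code_expand k n (bs : seq (block k.+1 n)) :
  recursive (fun v => code_word (expand v bs)).
Proof.
elim: bs => [|[u o] bs IHbs]; first exact: recursive_const.
have -> : (fun v => code_word (expand v ((u, o) :: bs))) = (fun v =>
    iter (if o is Some i then tnth v i else 1) (push_word u) (code_word (expand v bs))).
  apply/funext => v; rewrite {1}/expand /=.
  elim: (if o is Some i then _ else _) => //= m IHm.
  by rewrite -catA code_word_cat IHm.
apply: recursive_iter IHbs; first exact: recursive1_push_word.
by case: o => [i|]; [exact: recursive_proj|exact: recursive_const].
Qed.

(* With u and w representing s and t, and parameters (y, j), this spells
   [~ s ^+ y.+1, [~ t, t ^ (s ^+ j)]]. *)
Definition centralizer_test n (u w : word n) : seq (block 2 n) :=
  let j := (u, Some ord_max) in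
  comm_blocks [:: (u, None); (u, Some ord0)]
    (comm_blocks [:: (w, None)] (inv_blocks [:: j] ++ [:: (w, None); j])).

Lemma eval_centralizer_test (G : groupType) n (a : 'I_n -> G) u w y j :
  eval_word a (expand [tuple y; j] (centralizer_test u w)) =
  [~ eval_word a u ^+ y.+1, [~ eval_word a w, eval_word a w ^ (eval_word a u ^+ j)]]%g.
Proof.
rewrite /centralizer_test !eval_expand_comm; congr [~ _, [~ _, _]]%g.
- by rewrite (eval_expand_cat _ _ [:: (u, None)]) !eval_expand_block -expgS.
- exact: eval_expand_block.
- rewrite eval_expand_cat (eval_expand_cat _ _ [:: (w, None)]).
  by rewrite eval_expand_inv !eval_expand_block conjgE.
Qed.

(** Minimization finds the least successful [y]; its successor is positive and is the exponent of
    [s] in the intended tests. *)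
Lemma computable_search n (e : recf 1) (P : nat -> nat -> bool) (bs : seq (block 2 n)) :
  (forall y j, computes e [tuple code_word (expand [tuple y; j] bs)] (P y j)) ->
  (forall j, exists y, P y j) ->
  exists g, [/\ maps_pos g, computable g & forall j, exists2 y, P y j & g j = y.+1].
Proof.
move=> eP exP; have [ec ecP] := recursive_code_expand bs.
(* [RMu] stops at a zero whereas truth is coded by 1, so the answer of [e] is negated. *)
have [eneg enegP] : recursive1 (fun c => c == 0).
  apply: recursive1_of; have -> : (fun v : 1.-tuple nat => (thead v == 0) : nat) =
    (fun v => iter (thead v) (fun=> 0) 1) by apply/funext => v; case: (thead v).
  apply: recursive_iter; [|exact: recursive_proj|exact: recursive_const].
  exact: (@recursive1_of (fun=> 0) (recursive_const _ _)).
pose et := RComp eneg (fun=> RComp e (fun=> ec)).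
have etP y j : computes et [tuple y; j] (~~ P y j).
  have -> : ~~ P y j = (P y j == 0 :> nat) by case: (P y j).
  by apply: computes_comp1 (enegP _); apply: computes_comp1 (ecP _) (eP y j).
exists (fun j => (ex_minn (exP j)).+1); split => //; last first.
  by move=> j; case: ex_minnP => y Py _; exists y.
exists (RComp RSucc (fun=> RMu et)) => j _; case: ex_minnP => y Py ymin.
apply: (@computes_comp1 _ _ _ _ y) => //; split => [|z zy].
  have := etP y j; rewrite Py.
  by congr (computes et _ _); apply: val_inj.
exists 0; have /negbTE Pz : ~~ P z j by apply: contraTN zy => /ymin; rewrite leqNgt.
have := etP z j; rewrite Pz.
by congr (computes et _ _); apply: val_inj.
Qed.

(** * The rotation models restated for a degree [n] greater than 5 *)

Section CyclicGroups.
Variables (p q n : nat).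
Hypotheses (q2 : 2 < q) (nE : n = p * q + 2) (n5 : 5 < n).
Local Notation s := (alpha n ^+ q)%g.
Local Notation t := (beta n).

Lemma cyclic_comm_trivial j : j < p -> [~ t, t ^ (s ^+ j)]%g = 1%g.
Proof.
case: n nE n5 => [|[|D]] // DE D3; exact: (@model_comm_trivial D p q q2 DE D3).
Qed.

(** Here pq + 2 is coprime to q because q is odd. *)
Lemma cyclic_comm_order M :
  odd q -> 0 < M -> commute (s ^+ M)%g [~ t, t ^ (s ^+ p)]%g -> n <= M.
Proof.
move=> qodd M0; case: n nE n5 => [|[|D]] // DE D3.
apply: (@model_comm_order D p q q2 DE D3 M M0).
by rewrite /coprime DE gcdnC gcdnMDl -/(coprime q 2) coprimen2.
Qed.

End CyclicGroups.

Lemma alphaX_n n : (alpha n ^+ n = 1)%g.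
Proof.
case: n => [|[|D]]; last exact: alphaX_order.
- by rewrite expg0.
- by apply/permP => i; rewrite !ord1.
Qed.

(** * Coordinates of the direct product *)

Section Coordinates.
Variable d : nat -> nat.

(** Values are taken in the full symmetric group, where the rotation models live. *)
Definition coord (k : nat) (x : prod_Alt d) : {perm 'I_(d k.+1)} := sgval (x k).

Fact coord_morph k : (coord k 1%g = 1%g) * {morph @coord k : x y / (x * y)%g}.
Proof. by split=> // x y; exact: sgvalM. Qed.

HB.instance Definition _ k :=
  isUMagmaMorphism.Build (prod_Alt d) {perm 'I_(d k.+1)} (@coord k) (coord_morph k).

Lemma coord_ext (x y : prod_Alt d) : (forall k, coord k x = coord k y) -> x = y.
Proof.
by move=> xy; apply: functional_extensionality_dep => k; apply: val_inj; exact: xy.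
Qed.

End Coordinates.

(** * The group B_f: torsion of the tests, word problem, finite presentability *)

Section BfGroup.
Variables f F p q d : nat -> nat.
Hypothesis B : Bf_data f F p q d.
Local Notation s := (Bf_s q d).
Local Notation t := (Bf_t d).

Lemma Bf_p_ge k : 0 < k -> k <= p k.
Proof.
elim: k => // -[_ _|k IHk _]; first by rewrite (Bf_p1 B).
exact: leq_ltn_trans (IHk isT) (Bf_p_incr B _ _).
Qed.

Lemma Bf_d_large k : 0 < k -> F (p k) < d k.
Proof.
move=> k0; apply: leq_ltn_trans (Bf_d_gt B k0).
have pk := Bf_p_ge k0; have pk1 := Bf_p_incr B k0 (ltnSn k).
apply: leq_trans (Bf_F_incr B _ _) (leq_pmull _ _) => //; lia.
Qed.

Lemma Bf_d5 k : 0 < k -> 5 < d k.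
Proof.
move=> k0; apply: leq_ltn_trans (Bf_d_gt B k0).
have := @Bf_F_ge_id _ _ _ _ _ B (4 * p k.+1 + 4); lia.
Qed.

Lemma coord_s k : coord k s = (alpha (d k.+1) ^+ q k.+1)%g.
Proof. exact: Bf_sE (Bf_d_odd B (ltn0Sn k)). Qed.

Lemma coord_t k : coord k t = beta (d k.+1).
Proof. by apply: Bf_tE; apply: leq_trans (Bf_d5 (ltn0Sn k)). Qed.

Lemma coord_comm k M j :
  coord k [~ s ^+ M, [~ t, t ^ (s ^+ j)]]%g =
  [~ (alpha (d k.+1) ^+ q k.+1) ^+ M,
     [~ beta (d k.+1), beta (d k.+1) ^ ((alpha (d k.+1) ^+ q k.+1) ^+ j)]]%g.
Proof. by rewrite !gmulfR /= gmulfJ /= !gmulfXn /= coord_s coord_t. Qed.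

(** The exponent is the product of the first [j] degrees, which kills [s] in the first [j] factors.
    In the later ones [j <= k < p k.+1], so the inner commutator is trivial. *)
Lemma Bf_comm_torsion j :
  exists y, [~ s ^+ y.+1, [~ t, t ^ (s ^+ j)]]%g = 1%g.
Proof.
have M0 : 0 < \prod_(i < j) d i.+1.
  by apply: prodn_gt0 => i; apply: leq_ltn_trans (Bf_d5 (ltn0Sn i)).
exists (\prod_(i < j) d i.+1).-1; rewrite prednK //; apply: coord_ext => k.
rewrite coord_comm gmulf1; have [kj|jk] := ltnP k j.
  rewrite -!expgM (bigD1 (Ordinal kj)) //= mulnCA expgM alphaX_n expg1n.
  exact: comm1g.
rewrite (cyclic_comm_trivial (p := p k.+1)) ?comm1g ?commg1 //.
- exact: (Bf_q_gt2 B).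
- exact: (Bf_dE B).
- exact: Bf_d5.
- by apply: leq_trans (Bf_p_ge (ltn0Sn k)).
Qed.

Lemma Bf_comm_order k y : 0 < k ->
  [~ s ^+ y.+1, [~ t, t ^ (s ^+ p k)]]%g = 1%g -> d k <= y.+1.
Proof.
case: k => // k k0 /(congr1 (coord k)); rewrite coord_comm gmulf1 => /eqP/commgP.
apply: cyclic_comm_order => //.
- exact: (Bf_q_gt2 B).
- exact: (Bf_dE B).
- exact: Bf_d5.
- exact: (Bf_q_odd B).
Qed.

Lemma Bf_words n (a : 'I_n -> prod_Alt d) : generating_family (Bf q d) a ->
  exists u w, eval_word a u = s /\ eval_word a w = t.
Proof.
move=> gen; have Ba x : Bf q d x -> exists u, eval_word a u = x.
  by rewrite -gen => /generated_eval_word; apply.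
have [|u us] := Ba s; first by move=> A [_]; apply; left.
have [|w wt] := Ba t; first by move=> A [_]; apply; right.
by exists u, w.
Qed.

Lemma Bf_word_problem : outgrows_computable f -> ~ word_problem_solvable (Bf q d).
Proof.
move=> fast [n [a [gen [e eP]]]]; have [u [w [us wt]]] := Bf_words gen.
pose P y j := `[< [~ s ^+ y.+1, [~ t, t ^ (s ^+ j)]]%g = 1%g >].
have [||g [gpos gcomp gP]] := @computable_search n e P (centralizer_test u w).
- move=> y j; have [b [eb bP]] := eP (expand [tuple y; j] (centralizer_test u w)).
  suff -> : P y j = b by [].
  by apply/idP/idP => [/asboolP|/bP]; rewrite eval_centralizer_test us wt in bP *;
    [move/bP|move/asboolP].
- by move=> j; have [y yP] := Bf_comm_torsion j; exists y; apply/asboolP.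
have [N fN] := fast g gpos gcomp.
(* With k = N + 1 this yields the contradiction d(k) <= g(p(k)) < f(p(k)) <= F(p(k)) < d(k). *)
have := fN _ (leq_trans (leqnSn N) (Bf_p_ge (ltn0Sn N))).
have [y /asboolP /(Bf_comm_order (ltn0Sn N)) dy ->] := gP (p N.+1).
have := Bf_F_ge_f B (leq_trans (ltn0Sn N) (Bf_p_ge (ltn0Sn N))).
have := Bf_d_large (ltn0Sn N); lia.
Qed.

(** Both the target model and the coordinate [k = 2 * m] of B_f have p-parameter above [2 * m],
    hence are large enough for words of length [m]. The bound [p0] is uniform in [q'], which can
    therefore be chosen last. *)
Lemma Bf_words_agree m : exists p0, forall p' q' (w : word 2),
  p0 <= p' -> 2 < q' -> size w <= m -> eval_word (pair_family s t) w = 1%g ->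
  eval_word (pair_family (alpha (p' * q' + 2) ^+ q') (beta (p' * q' + 2)))%g w = 1%g.
Proof.
exists (2 * m).+1 => p' q' w p0p' q'2 wm w1.
have mp' : 2 * m * q' < p' * q' by rewrite ltn_pmul2r //; lia.
pose k := 2 * m; have mp : 2 * m * q k.+1 < p k.+1 * q k.+1.
  by rewrite ltn_pmul2r ?(ltnW (ltnW (Bf_q_gt2 B _))) //; exact: Bf_p_ge.
have := congr1 (coord k) w1; rewrite eval_word_morph gmulf1.
have -> : coord k \o pair_family s t =
    pair_family (alpha (d k.+1) ^+ q k.+1)%g (beta (d k.+1)).
  by apply/funext => i; rewrite /pair_family /=;
    case: (val i) => [|_]; rewrite ?coord_s ?coord_t.
rewrite (Bf_dE B) // !addn2; apply: model_words_agree mp mp' wm => //.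
exact: (Bf_q_gt2 B).
Qed.

Lemma Bf_not_finitely_presented : ~ finitely_presented (Bf q d).
Proof.
move=> [n [a [R [gen aR]]]]; have [u [w [us wt]]] := Bf_words gen.
have /choice[A AP] : forall i, exists v, eval_word (pair_family s t) v = a i.
  move=> i; apply: (@generated_eval_word _ _ _ [set s; t]%classic).
    rewrite -/(Bf q d _) -gen => X [_]; apply; by exists i.
  by rewrite range_pair_family.
have aE v : eval_word (pair_family s t) (subst_word A v) = eval_word a v.
  by rewrite eval_subst_word; congr (eval_word _ v); apply/funext.
(* Their triviality in the model says that the relators hold there and that [u] and [w] evaluate to
   [s'] and [t']; the appended letters are the inverses of [s] and [t]. *)
pose tests := [:: subst_word A u ++ [:: (ord0, true)],
    subst_word A w ++ [:: (ord_max, true)]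
  & map (subst_word A) R].
pose m := \max_(v <- tests) size v.
have [p0 p0P] := Bf_words_agree m.
(* First [p'] determines the exponent [y.+1], then [q'] is taken odd and larger than it. Having [p']
   at least 2 makes the degree exceed 5. *)
pose p' := p0.+2; have [y yP] := Bf_comm_torsion p'; pose q' := y.*2.+3.
pose s' := (alpha (p' * q' + 2) ^+ q')%g; pose t' := beta (p' * q' + 2).
pose b i := eval_word (pair_family s' t') (A i).
have testP v : v \in tests -> eval_word (pair_family s t) v = 1%g ->
    eval_word (pair_family s' t') v = 1%g.
  move=> tv; apply: p0P => //; first by rewrite /p'; lia.
  exact: leq_bigmax_seq.
have bR r : r \in R -> eval_word b r = 1%g.
  move=> Rr; rewrite -eval_subst_word; apply: testP.
    by rewrite !inE map_f ?orbT.
  rewrite aE -(eval_word_nil a); apply/aR.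
  by have := PresRel [::] [::] Rr; rewrite cats0.
have bs : eval_word b u = s'.
  apply/divg1_eq; have := testP _ (mem_head _ _).
  rewrite !eval_word_cat aE us !eval_word_cons !eval_word_nil !mulg1 eval_subst_word.
  by apply; rewrite mulgV.
have bt : eval_word b w = t'.
  have := testP (subst_word A w ++ [:: (ord_max, true)]).
  rewrite !inE eqxx orbT !eval_word_cat aE wt !eval_word_cons !eval_word_nil !mulg1.
  rewrite eval_subst_word => bw; apply/divg1_eq/bw => //; exact: mulgV.
(* [z] is trivial in B_f, hence a consequence of the relators, hence trivial in the model; this
   forces [p' * q' + 2 <= y.+1], which is absurd. *)
pose z := expand [tuple y; p'] (centralizer_test u w).
have : eval_word b z = eval_word b [::].
  apply: (presented_eq_eval bR); apply/aR.
  by rewrite eval_centralizer_test us wt yP eval_word_nil.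
rewrite eval_centralizer_test bs bt eval_word_nil => /eqP/commgP.
have q'2 : 2 < q' by [].
have n5 : 5 < p' * q' + 2 by rewrite /p' /q'; nia.
move=> /(cyclic_comm_order q'2 (erefl _) n5).
rewrite /q' /= odd_double => /(_ isT isT); rewrite /p' -/q'; nia.
Qed.

End BfGroup.

Theorem corollary1 (f F p q d : nat -> nat) :
  maps_pos f -> outgrows_computable f -> Bf_data f F p q d ->
  ~ finitely_presented (Bf q d) /\
  (~ fin_index_normal_membership_solvable (Bf q d) \/
   ~ word_problem_solvable (Bf q d)).
Proof.
move=> fpos fast B; split; first exact: Bf_not_finitely_presented B.
by right; exact: Bf_word_problem B fast.
Qed.
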